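(* Let $A$ be a real symmetric $n\times n$ matrix and let $\{u_k\}$ be a sequence of unit vectors generated by the MSJD method applied to $A$, with Rayleigh quotients $\rho_k:=u_k^\ast A u_k$. Let $\alpha\ge 0$ be such that $\alpha^2=\lim_{k\to\infty}\|(A-\rho_k I)u_k\|^2$. Then $\rho_k$ converges to some $\rho\in\mathbb{R}$, and the sequence $\{u_k\}$ of eigenvector approximations converges either to an eigenvector of $A$ corresponding to the eigenvalue $\rho$, or to a vector in an invariant subspace of $A$ corresponding to the eigenvalue $\rho$, or to a vector in an invariant subspace of $A$ spanned by eigenvectors corresponding to eigenvalues $\rho\pm\alpha$.
   Context: $\|\cdot\|$ is the Euclidean norm and $^\ast$ the (conjugate) transpose. The Modified Simplified Jacobi-Davidson (MSJD) method for a matrix $A$ starts from a unit vector and, given the current unit vector $u_k$ with Rayleigh quotient $\rho_k=u_k^\ast A u_k$, computes $u_{k+1}$ as follows. Step 1: find a vector $t_k$ that minimizes, over all vectors $t$, the quantity $\|(A-\rho_k I)u_k+(A-\rho_k I)(I-u_ku_k^\ast)t\|^2$. Step 2: set $u_{k+1}=\dfrac{u_k+(I-u_ku_k^\ast)t_k}{\|u_k+(I-u_ku_k^\ast)t_k\|}$. The sequence $\|(A-\rho_k I)u_k\|^2$ is non-increasing and nonnegative, so the limit $\alpha^2$ exists.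
   Formalization: ''Converges to a vector in an invariant subspace for ρ'' is read as: the distance from u_k to the eigenspace of ρ tends to 0, allowed only if ρ is a multiple eigenvalue and some u_k has zero residual; as worded it fails for A = I_2, u_k = (cos k, sin k). *)

(* Defs.v *)
From HB Require Import structures.
From mathcomp Require Export all_boot all_order all_algebra.
From mathcomp Require Export all_classical all_reals all_analysis.

Set Implicit Arguments.
Unset Strict Implicit.
Unset Printing Implicit Defensive.

Import Order.TTheory GRing.Theory Num.Theory.
Import numFieldNormedType.Exports.

Local Open Scope classical_set_scope.
Local Open Scope ring_scope.

(* The library norm `|v| on matrices is the sup norm.  It induces the same
   topology as the Euclidean norm, so that u @ \oo --> v in 'cV[R]_n is the
   usual convergence of vectors. *)
Definition euclid_norm (R : realType) (n : nat) (v : 'cV[R]_n) : R :=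
  Num.sqrt (\sum_(i < n) v i 0 ^+ 2).

Definition rayleigh (R : realType) (n : nat) (A : 'M[R]_n) (u : 'cV[R]_n) : R :=
  (u^T *m A *m u) 0 0.

Definition residual (R : realType) (n : nat) (A : 'M[R]_n) (u : 'cV[R]_n) :
    'cV[R]_n :=
  (A - (rayleigh A u)%:M) *m u.

(* I - u u^*; the orthogonal projection onto the complement of u when u is a
   unit vector. *)
Definition proj_orth (R : realType) (n : nat) (u : 'cV[R]_n) : 'M[R]_n :=
  1%:M - u *m u^T.

Definition msjd_objective (R : realType) (n : nat) (A : 'M[R]_n)
    (u t : 'cV[R]_n) : R :=
  euclid_norm (residual A u
               + (A - (rayleigh A u)%:M) *m proj_orth u *m t) ^+ 2.

(* A relation rather than a function: the minimizer t need not be unique, and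
   any minimizer may be chosen. *)
Definition msjd_step (R : realType) (n : nat) (A : 'M[R]_n)
    (u u' : 'cV[R]_n) : Prop :=
  exists t : 'cV[R]_n,
    (forall s : 'cV[R]_n, msjd_objective A u t <= msjd_objective A u s) /\
    u' = (euclid_norm (u + proj_orth u *m t))^-1 *: (u + proj_orth u *m t).

Definition msjd_sequence (R : realType) (n : nat) (A : 'M[R]_n)
    (u : nat -> 'cV[R]_n) : Prop :=
  euclid_norm (u 0%N) = 1 /\ forall k : nat, msjd_step A (u k) (u k.+1).

Definition is_eigenvector (R : realType) (n : nat) (A : 'M[R]_n) (a : R)
    (v : 'cV[R]_n) : Prop :=
  A *m v = a *: v /\ v != 0.

(* The library represents subspaces by row spaces and lets matrices act on row
   vectors from the right; transposing A gives the eigenspace of A acting on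
   columns: A *m v = a *: v iff (v^T <= col_eigenspace A a)%MS. *)
Definition col_eigenspace (R : realType) (n : nat) (A : 'M[R]_n) (a : R) :
    'M[R]_n :=
  eigenspace A^T a.

(* Euclidean distance from v to the subspace spanned by the rows of W. *)
Definition dist_subspace (R : realType) (n : nat) (W : 'M[R]_n)
    (v : 'cV[R]_n) : R :=
  inf [set d : R | exists w : 'cV[R]_n,
                     (w^T <= W)%MS /\ d = euclid_norm (v - w)].

(* Main.v *)
(* Every minimizer y = u_k + (I - u_k u_k^T) t satisfies the Lagrange condition
   (A - rho_k)^2 y = |(A - rho_k) y|^2 u_k, whether or not A - rho_k is singular.
   Hence the squared residuals r_k obey r_(k+1) + (rho_(k+1) - rho_k)^2 <= r_k, so the steps
   of rho_k vanish, and
   |((A - rho_k)^2 - alpha^2) u_(k+1)|^2 <= r_k^2 - alpha^4 -> 0.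
   A cluster point x of (rho_k) therefore makes x + alpha or x - alpha an
   eigenvalue; there are finitely many such x, so rho_k converges to some rho, and
   the distance from u_k to the sum of the eigenspaces for rho +/- alpha tends to 0.
   As long as no residual vanishes, the component of u_k in an eigenspace, once
   nonzero, is only rescaled by positive factors; its norm converges (to 1 if
   alpha = 0, to 1/sqrt 2 on both sides otherwise, because rho_k is a mean), hence
   so does the component itself. *)

Require Import Defs.
From mathcomp Require Import ring lra.
Import Order.TTheory GRing.Theory Num.Theory.
Import numFieldNormedType.Exports.

Local Open Scope classical_set_scope.
Local Open Scope ring_scope.

(** * The Euclidean inner product on column vectors *)

Section Dot.
Context {R : realType} {n : nat}.
Implicit Types (u v w : 'cV[R]_n) (M : 'M[R]_n) (a : R).

Definition dot u v : R := (u^T *m v) 0 0.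

Lemma dotE u v : dot u v = \sum_i u i 0 * v i 0.
Proof. by rewrite /dot mxE; apply: eq_bigr => i _; rewrite mxE. Qed.

Lemma dotC u v : dot u v = dot v u.
Proof. by rewrite !dotE; apply: eq_bigr => i _; rewrite mulrC. Qed.

Lemma dotDr u v w : dot u (v + w) = dot u v + dot u w.
Proof. by rewrite /dot mulmxDr mxE. Qed.

Lemma dotZr a u v : dot u (a *: v) = a * dot u v.
Proof. by rewrite /dot -scalemxAr mxE. Qed.

Lemma dotDl u v w : dot (v + w) u = dot v u + dot w u.
Proof. by rewrite dotC dotDr !(dotC u). Qed.

Lemma dotZl a u v : dot (a *: v) u = a * dot v u.
Proof. by rewrite dotC dotZr dotC. Qed.

Lemma dotNr u v : dot u (- v) = - dot u v.
Proof. by rewrite -scaleN1r dotZr mulN1r. Qed.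

Lemma dotNl u v : dot (- v) u = - dot v u.
Proof. by rewrite dotC dotNr dotC. Qed.

Lemma dot0r u : dot u 0 = 0.
Proof. by rewrite /dot mulmx0 mxE. Qed.

Definition dot_lin := (dotDl, dotDr, dotNl, dotNr, dotZl, dotZr).

Lemma dot_mulmxl M u v : dot (M *m u) v = dot u (M^T *m v).
Proof. by rewrite /dot trmx_mul mulmxA. Qed.

Lemma sqr_coord_le u i : u i 0 ^+ 2 <= dot u u.
Proof.
rewrite dotE (bigD1 i) //= -expr2 lerDl.
by apply: sumr_ge0 => j _; rewrite -expr2 sqr_ge0.
Qed.

Lemma dot_ge0 u : 0 <= dot u u.
Proof. by rewrite dotE sumr_ge0 // => i _; rewrite -expr2 sqr_ge0. Qed.

Lemma dot_eq0 u : dot u u = 0 -> u = 0.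
Proof.
move=> u0; apply/colP => i; rewrite mxE; apply/eqP; rewrite -sqrf_eq0.
by rewrite eq_le sqr_ge0 andbT -u0 sqr_coord_le.
Qed.

Lemma dot_gt0 u : (0 < dot u u) = (u != 0).
Proof.
rewrite lt0r dot_ge0 andbT; congr negb; apply/eqP/eqP => [/dot_eq0 //|->].
exact: dot0r.
Qed.

Lemma dotD_le u v : dot (u + v) (u + v) <= 2 * dot u u + 2 * dot v v.
Proof. have := dot_ge0 (u - v); rewrite !dot_lin (dotC v u); lra. Qed.

(** Each coordinate of [M *m v] is at most the absolute sum of that row times the Euclidean norm of
    [v], because this norm bounds every coordinate of [v]. *)
Lemma dot_mulmx_bounded M :
  exists2 C : R, 0 <= C & forall v, dot (M *m v) (M *m v) <= C * dot v v.
Proof.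
exists (\sum_i (\sum_j `|M i j|) ^+ 2).
  by apply: sumr_ge0 => i _; exact: sqr_ge0.
move=> v; rewrite (dotE (M *m v)) mulr_suml; apply: ler_sum => i _.
rewrite -expr2 -[dot v v]sqr_sqrtr ?dot_ge0// -exprMn -[leLHS]real_normK ?num_real//.
rewrite lerXn2r ?nnegrE ?normr_ge0//.
  by rewrite mulr_ge0 ?sqrtr_ge0// sumr_ge0.
rewrite mxE (le_trans (ler_norm_sum _ _ _))// mulr_suml; apply: ler_sum => j _.
rewrite normrM ler_wpM2l// -sqrtr_sqr ler_sqrt ?dot_ge0//.
exact: sqr_coord_le.
Qed.

Lemma sqr_euclid_norm u : euclid_norm u ^+ 2 = dot u u.
Proof.
rewrite /euclid_norm sqr_sqrtr; first by rewrite dotE; apply: eq_bigr.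
by rewrite sumr_ge0 // => i _; rewrite sqr_ge0.
Qed.

Lemma rayleighE M u : rayleigh M u = dot u (M *m u).
Proof. by rewrite /rayleigh /dot mulmxA. Qed.

End Dot.

(** * One step of the method: Lagrange condition and energy identity *)

Section Step.
Context {R : realType} {n : nat}.
Context {A : 'M[R]_n} (hA : A^T = A).
Implicit Types (u v w : 'cV[R]_n).

Let rho := rayleigh A.
Let r u := dot (residual A u) (residual A u).

Lemma residualE u : residual A u = A *m u - rho u *: u.
Proof. by rewrite /residual mulmxBl mul_scalar_mx. Qed.

Lemma residual_eq0P u : reflect (A *m u = rho u *: u) (r u == 0).
Proof.
apply: (iffP eqP) => [/dot_eq0/eqP|e];
  rewrite ?/r residualE ?subr_eq0 ?e ?subrr ?dot0r//.
by move/eqP.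
Qed.

Lemma dot_symmetric u v : dot (A *m u) v = dot u (A *m v).
Proof. by rewrite dot_mulmxl hA. Qed.

(** Pythagoras: the vector is the residual plus [(rho u - a) *: u], and the residual of a unit
    vector is orthogonal to it. *)
Lemma dot_shift u (a : R) : dot u u = 1 ->
  dot (A *m u - a *: u) (A *m u - a *: u) = r u + (rho u - a) ^+ 2.
Proof.
move=> u1; rewrite /r residualE !dot_lin.
by rewrite (dotC (A *m u) u) u1 -rayleighE -/rho; ring.
Qed.

(* B = A - rho u; [c d] is the minimum of step 1 divided by the squared norm of
   the minimizer, and B^2 u' = c u is the Lagrange condition for it. *)
Lemma msjd_step_lagrange {u u'} : dot u u = 1 -> msjd_step A u u' ->
  exists c d : R, let B v := A *m v - rho u *: v in
  [/\ 0 < d <= 1, c <= r u * d, dot u u' = d, dot u' u' = 1 & B (B u') = c *: u].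
Proof.
move=> u1 [t [tmin ->]].
set y := u + _ *m t.
have [B BE] : exists B, forall v, B v = A *m v - rho u *: v by eexists.
have BD v w : B (v + w) = B v + B w.
  by rewrite !BE mulmxDr scalerDr opprD addrACA.
have BZ a v : B (a *: v) = a *: B v.
  by rewrite !BE -scalemxAr scalerA mulrC -scalerA scalerBr.
have Bsym v w : dot (B v) w = dot v (B w).
  by rewrite !BE !dot_lin dot_symmetric.
have PE s : proj_orth u *m s = s - dot u s *: u.
  rewrite /proj_orth mulmxBl mul1mx -mulmxA; congr (_ - _).
  by rewrite [u^T *m s]mx11_scalar -/(dot u s) mul_mx_scalar.
have objE s :
    msjd_objective A u s = dot (B (u + proj_orth u *m s)) (B (u + proj_orth u *m s)).
  rewrite /msjd_objective sqr_euclid_norm residualE -BE BD -mulmxA.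
  by rewrite (BE (_ *m s)) (mulmxBl A) mul_scalar_mx.
have uy : dot u y = 1 by rewrite /y PE !dot_lin u1; ring.
(* The projection fixes every [z] orthogonal to [u], so [y] minimizes |B y| on the affine hyperplane
   <u, y> = 1. *)
have ymin z : dot u z = 0 -> dot (B y) (B y) <= dot (B (y + z)) (B (y + z)).
  move=> uz; have := tmin (t + z); rewrite !objE mulmxDr addrA.
  by rewrite [_ *m z]PE uz scale0r subr0.
have taur : dot (B y) (B y) <= r u.
  by have := tmin 0; rewrite !objE mulmx0 addr0 /r residualE -BE.
clearbody y.
have yy : 1 <= dot y y.
  by have := dot_ge0 (y - u); rewrite !dot_lin (dotC y u) uy u1; lra.
set tau := dot (B y) (B y) in taur *.
have orth z : dot u z = 0 -> dot (B y) (B z) = 0.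
  move=> uz.
  have H (e : R) : 0 <= 2 * e * dot (B y) (B z) + e ^+ 2 * dot (B z) (B z).
    have := ymin (e *: z); rewrite dotZr uz mulr0 => /(_ erefl).
    by rewrite BD BZ !dot_lin (dotC (B z) (B y)); lra.
  have := dot_ge0 (B z); set b := dot (B z) _ in H *; set a := dot _ _ in H *.
  (* Nearly the optimal step of the variation; [b + 1] replaces [b] so that [B z = 0] needs no
     separate case. *)
  move=> b0; have := H (- a / (b + 1)).
  have b1 : b + 1 != 0 by rewrite gt_eqF// ltr_wpDl.
  have -> : 2 * (- a / (b + 1)) * a + (- a / (b + 1)) ^+ 2 * b
     = - (a / (b + 1)) ^+ 2 * (b + 2) by field.
  rewrite mulNr oppr_ge0 => H1.
  have : (a / (b + 1)) ^+ 2 = 0.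
    by apply/eqP; rewrite eq_le sqr_ge0 andbT -(pmulr_lle0 _ (_ : 0 < b + 2))//; lra.
  move/eqP; rewrite sqrf_eq0 mulf_eq0 invr_eq0 (negbTE b1) orbF => /eqP //.
have lagr : B (B y) = tau *: u.
  apply/eqP; rewrite -subr_eq0; apply/eqP/dot_eq0.
  set t' := dot u (B (B y)).
  (* [B (B y)] is orthogonal to everything orthogonal to [u], hence a multiple of [u]; pairing with
     [y] then identifies the factor as [tau]. *)
  have Z : B (B y) = t' *: u.
    apply/eqP; rewrite -subr_eq0; apply/eqP/dot_eq0.
    set z := _ - _; have uz : dot u z = 0 by rewrite /z !dot_lin u1 -/t'; ring.
    by rewrite {1}/z dotDl dotNl dotZl uz mulr0 subr0 Bsym orth.
  have -> : tau = t' by rewrite /tau Bsym Z dotZr dotC uy mulr1.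
  by rewrite Z subrr dot0r.
set s := euclid_norm y.
have s2 : s ^+ 2 = dot y y by exact: sqr_euclid_norm.
have s1 : 1 <= s by rewrite -(@expr_ge1 _ 2) ?s2// sqrtr_ge0.
have s0 : 0 < s by exact: lt_le_trans s1.
(* Normalizing divides the Lagrange condition for [y] by [s], and turns <u, y> = 1 into [s^-1]. *)
exists (tau / s), (s^-1); split.
- by rewrite invr_gt0 s0 invf_le1.
- by rewrite ler_wpM2r// invr_ge0 ltW.
- by rewrite dotZr uy mulr1.
- by rewrite !dot_lin -s2; field; rewrite gt_eqF.
- by rewrite /= -!BE !BZ lagr scalerA mulrC.
Qed.

(** As [B] is symmetric, |B u'|^2 = <u', B (B u')> = c d, and Pythagoras evaluates |B u'|^2 as the
    residual of [u'] plus the squared change of [rho]. *)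
Lemma msjd_stepP {u u'} : dot u u = 1 -> msjd_step A u u' ->
  exists c d : R, let B v := A *m v - rho u *: v in
  [/\ [/\ 0 < d <= 1, dot u u' = d & dot u' u' = 1],
      B (B u') = c *: u,
      r u' + (rho u' - rho u) ^+ 2 = c * d,
      0 <= c <= r u & c * d <= r u].
Proof.
move=> u1 /(msjd_step_lagrange u1)[c [d /= [/andP[d0 d1] cr uu' u'1 BB]]].
have m : r u' + (rho u' - rho u) ^+ 2 = c * d.
  rewrite -dot_shift// dotDl dotNl dotZl dot_symmetric -dotZr -dotNr -dotDr.
  by rewrite BB dotZr dotC uu'.
have r0 : 0 <= r u by exact: dot_ge0.
have c0 : 0 <= c.
  by rewrite -(pmulr_lge0 _ d0) -m addr_ge0 ?sqr_ge0// dot_ge0.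
have cr' : c <= r u by rewrite (le_trans cr)// ler_piMr.
exists c, d; split => //; first by rewrite d0.
  by rewrite c0.
by rewrite (le_trans _ cr')// ler_piMr.
Qed.

End Step.

(** * Real sequences with vanishing steps and finitely many possible cluster points *)

Section RealSequences.
Context {R : realType}.
Implicit Types (x : nat -> R) (p : {poly R}).

(** The [size p] distinct points [e / j.+2%:R] are too many to be all roots. *)
Lemma poly_neq0_nonroot p (e : R) : p != 0 -> 0 < e ->
  exists2 d, 0 < d < e & ~~ root p d.
Proof.
move=> p0 e0; apply: contrapT => H.
pose s := [seq e / j.+2%:R | j <- iota 0 (size p)].
have : (size s < size p)%N.
  apply: max_poly_roots => //.
    apply/allP => _ /mapP[j _ ->]; apply: contrapT => /negP nr; apply: H.
    exists (e / j.+2%:R) => //; rewrite divr_gt0//= ltr_pdivrMr// ltr_pMr//.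
    by rewrite ltr1n.
  rewrite map_inj_uniq ?iota_uniq// => i j /(mulfI (lt0r_neq0 e0))/invr_inj/eqP.
  by rewrite eqr_nat => /eqP[].
by rewrite size_map size_iota ltnn.
Qed.

Lemma poly_comp_linear_neq0 p (a b : R) : p != 0 -> b != 0 ->
  p \Po (b *: 'X + a%:P) != 0.
Proof.
move=> p0 b0; rewrite -size_poly_eq0 size_comp_poly2 ?size_poly_eq0//.
by rewrite -mul_polyC size_MXaddC polyC_eq0 (negbTE b0) size_polyC b0.
Qed.

Lemma cluster_bounded_seq x (K : R) : (forall k, `|x k| <= K) ->
  exists a, cluster (x @ \oo) a.
Proof.
move=> xK; have [|a [_ ?]] := @segment_compact R (- K) K (x @ \oo) _.
  by exists 0%N => // k _; rewrite /= in_itv/= -ler_norml.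
by exists a.
Qed.

(* If x did not converge to its cluster point a, it would oscillate between a
   and the exterior of a ball; as its steps vanish, it would cluster on every
   small sphere around a, although polynomials have finitely many roots. *)
Lemma cvg_of_cluster_roots x (K : R) p : p != 0 -> (forall k, `|x k| <= K) ->
  (fun k => x k.+1 - x k) @ \oo --> 0 ->
  (forall a, cluster (x @ \oo) a -> root p a) ->
  exists a : R, x @ \oo --> a.
Proof.
move=> p0 xK dx clp; have [a cla] := cluster_bounded_seq x K xK.
exists a; apply: contrapT => ncv.
have [e e0 far] : exists2 e : R, 0 < e &
    forall N, exists2 k, (N <= k)%N & e <= `|a - x k|.
  apply: contrapT => H; apply: ncv; apply/cvgrPdist_lt => e e0.
  apply: contrapT => H'; apply: H; exists e => // N.
  apply: contrapT => H; apply: H'; exists N => // k /= Nk.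
  by rewrite ltNge; apply/negP => ?; apply: H; exists k.
(* A root [d] of [q] is a radius for which [a + d] or [a - d] is a root of [p]; a nonroot [d < e]
   gives a sphere without cluster points. *)
pose q := (p \Po (1 *: 'X + a%:P)) * (p \Po ((- 1) *: 'X + a%:P)).
have q0 : q != 0.
  by rewrite mulf_neq0// poly_comp_linear_neq0// oppr_eq0 oner_neq0.
have [d /andP[d0 de]] := poly_neq0_nonroot q e q0 e0.
rewrite /root /q hornerM mulf_eq0 !horner_comp !hornerE => /negP; apply.
rewrite mulN1r (addrC d) (addrC (- d)); apply: contrapT => /negP.
rewrite negb_or => /andP[n1 n2].
have sphere h N : 0 < h -> exists2 m, (N <= m)%N & `| `|a - x m| - d| < h.
  move=> h0; move/cvgrPdist_lt: dx => /(_ _ h0)[N' _ HN'].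
  move/cluster_eventuallyP: cla => /(_ (d / 2) (maxn N N')).
  rewrite divr_gt0// => /(_ erefl)[k kN kd].
  have [m0 km0 m0e] := far k.
  (* Since [x k] is within [d / 2] of [a], the first later index at distance at least [d] is one
     short step away from a point inside the ball, hence close to the sphere. *)
  have ex : exists m, (k <= m)%N && (d <= `|a - x m|).
    by exists m0; rewrite km0 (le_trans (ltW de)).
  case: (ex_minnP ex) => [] [|m] /andP[km dm] mmin.
    move: km; rewrite leqn0 => /eqP k0; move: kd; rewrite k0 => kd.
    by move: (le_trans dm kd); lra.
  move: km; rewrite leq_eqVlt => /orP[/eqP km|].
    by move: kd; rewrite km => /(le_trans dm); lra.
  rewrite ltnS => km.
  exists m.+1.
    by rewrite (leq_trans _ (leqW km))// (leq_trans _ kN)// leq_maxl.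
  have dlt : `|a - x m| < d.
    rewrite ltNge; apply/negP => dm'.
    by have := mmin m; rewrite km dm' ltnn => /(_ erefl).
  have := HN' m; rewrite /= (leq_trans _ km) ?(leq_trans _ kN) ?leq_maxr//.
  move=> /(_ erefl); rewrite sub0r normrN => step.
  rewrite ger0_norm ?subr_ge0//.
  have : `|a - x m.+1| <= `|a - x m| + `|x m.+1 - x m|.
    by rewrite -[a - x m.+1](_ : (a - x m) - (x m.+1 - x m) = _) ?ler_normB//; ring.
  lra.
have ncl c : p.[c] != 0 ->
    exists2 h, 0 < h & exists N, forall k, (N <= k)%N -> h < `|c - x k|.
  move=> pc; apply: contrapT => H; move/negP: pc; apply; apply: clp.
  apply/cluster_eventuallyP => h N h0; apply: contrapT => H'; apply: H.
  exists h => //; exists N => k Nk; rewrite ltNge; apply/negP => ?; apply: H'.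
  by exists k.
have [h1 h10 [N1 H1]] := ncl _ n1; have [h2 h20 [N2 H2]] := ncl _ n2.
have h0 : 0 < Num.min h1 h2 by rewrite lt_min h10.
have [m] := sphere _ (maxn N1 N2) h0.
rewrite geq_max lt_min => /andP[/H1 H1m /H2 H2m] /andP[].
(* The side of [a] on which [x m] lies decides which of [a - d] and [a + d] it is too close to. *)
rewrite !ltr_norml; have [s|s] := ger0P (a - x m) => /andP[? ?] /andP[? ?].
  by move: H2m; case: ger0P; lra.
by move: H1m; case: ger0P; lra.
Qed.

End RealSequences.

(** * Convergence of vectors in Euclidean terms *)

Section VectorSequences.
Context {R : realType} {n : nat}.
Implicit Types (u v w : nat -> 'cV[R]_n).

Lemma cvg_cVP u (a : 'cV[R]_n) :
  (forall i, (fun k => u k i 0) @ \oo --> a i 0) -> u @ \oo --> a.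
Proof.
move=> H P [Q Qa QP].
have : forall i : 'I_n, \forall k \near \oo, Q i 0 (u k i 0).
  by move=> i; exact: H (Qa i 0).
move/filter_forall; apply: filterS => k Qk; apply: QP => i j.
by rewrite ord1; exact: Qk.
Qed.

(** Bridge between the library topology and the Euclidean norm: coordinates converge in one
    direction, and the squared norm dominates each squared coordinate in the other. *)
Lemma cvg_dot_sub u (a : 'cV[R]_n) :
  u @ \oo --> a <-> (fun k => dot (u k - a) (u k - a)) @ \oo --> 0.
Proof.
split=> H.
  have Hi i : (fun k => u k i 0) @ \oo --> a i 0.
    exact: (cvg_comp _ _ H (@coord_continuous _ _ _ i 0 a)).
  have -> : (fun k => dot (u k - a) (u k - a)) =
      (fun k => \sum_(i < n) (u k i 0 - a i 0) * (u k i 0 - a i 0)).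
    by apply/funext => k; rewrite dotE; apply: eq_bigr => i _; rewrite !mxE.
  rewrite [X in _ --> X](_ : 0 = \sum_(i < n) (a i 0 - a i 0) * (a i 0 - a i 0));
    last first.
    by rewrite big1// => i _; rewrite subrr mul0r.
  apply: cvg_big => [|i _]; first exact: add_continuous.
  apply: cvgM; (apply: cvgB; [exact: Hi|exact: cvg_cst]).
apply: cvg_cVP => i; apply/cvgrPdist_lt => e e0.
have /cvgrPdist_lt/(_ (e ^+ 2)) := H; rewrite exprn_gt0// => /(_ erefl).
apply: filterS => k; rewrite sub0r normrN ger0_norm ?dot_ge0// => lte.
rewrite -(@ltr_pXn2r _ 2) ?nnegrE ?normr_ge0 ?(ltW e0)//.
rewrite real_normK ?num_real// (le_lt_trans _ lte)//.
by rewrite -sqrrN opprB (le_trans _ (sqr_coord_le _ i))// !mxE.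
Qed.

Lemma cvg0_dot u :
  u @ \oo --> (0 : 'cV[R]_n) <-> (fun k => dot (u k) (u k)) @ \oo --> 0.
Proof.
rewrite cvg_dot_sub; have -> // : (fun k => dot (u k - 0) (u k - 0)) =
  (fun k => dot (u k) (u k)) by apply/funext => k; rewrite subr0.
Qed.

Lemma cvg_mulmxr (M : 'M[R]_n) u (a : 'cV[R]_n) :
  u @ \oo --> a -> (fun k => M *m u k) @ \oo --> M *m a.
Proof.
move=> /cvg_dot_sub ua; apply/cvg_dot_sub.
have [C C0 HC] := dot_mulmx_bounded M.
apply: (@squeeze_cvgr _ _ _ _ (fun=> 0) (fun k => C * dot (u k - a) (u k - a))).
- by apply: nearW => k; rewrite dot_ge0 -mulmxBr HC.
- exact: cvg_cst.
- by rewrite -(mulr0 C); apply: cvgM => //; exact: cvg_cst.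
Qed.

Lemma cvg_dot u v (a b : 'cV[R]_n) : u @ \oo --> a -> v @ \oo --> b ->
  (fun k => dot (u k) (v k)) @ \oo --> dot a b.
Proof.
move=> ua vb; have coord w (c : 'cV[R]_n) i :
    w @ \oo --> c -> (fun k => w k i 0) @ \oo --> c i 0.
  by move=> wc; exact: (cvg_comp _ _ wc (@coord_continuous _ _ _ i 0 c)).
rewrite dotE (_ : (fun k => _) = (fun k => \sum_i u k i 0 * v k i 0)); last first.
  by apply/funext => k; rewrite dotE.
apply: cvg_big => [|i _]; first exact: add_continuous.
by apply: cvgM; exact: coord.
Qed.

(** From some [N] on, the sequence stays on the ray through [w N]. The factors being nonnegative,
    the coefficient on this ray is a square root of a quotient of squared norms, and these
    converge. *)
Lemma cvg_fixed_direction w (l : R) :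
  (\forall k \near \oo, exists2 t : R, 0 <= t & w k.+1 = t *: w k) ->
  (fun k => dot (w k) (w k)) @ \oo --> l ->
  exists a : 'cV[R]_n, w @ \oo --> a.
Proof.
move=> [N _ HN] wl; set w0 := w N.
have ray k : exists2 c : R, 0 <= c & w (k + N)%N = c *: w0.
  elim: k => [|k [c c0 wk]]; first by exists 1; rewrite ?scale1r.
  have [|t t0 E] := HN (k + N)%N; first by rewrite /= leq_addl.
  by exists (t * c); rewrite ?mulr_ge0// addSn E wk scalerA.
have [w00|w00] := eqVneq w0 0.
  exists 0; rewrite -(cvg_shiftn N).
  rewrite (_ : (fun k => _) = (fun=> 0)); first exact: cvg_cst.
  by apply/funext => k; have [c _ ->] := ray k; rewrite w00 scaler0.
have w0gt : 0 < dot w0 w0 by rewrite dot_gt0.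
exists (Num.sqrt (l / dot w0 w0) *: w0); rewrite -(cvg_shiftn N).
rewrite (_ : (fun k => _) =
  (fun k => Num.sqrt (dot (w (k + N)%N) (w (k + N)%N) / dot w0 w0) *: w0)).
  apply: cvgZl; apply: (continuous_cvg _ (@sqrt_continuous R _)).
  apply: cvgM; last exact: cvg_cst.
  by rewrite (cvg_shiftn N (fun k => dot (w k) (w k))).
apply/funext => k; have [c c0 ->] := ray k; rewrite !dot_lin mulrA.
rewrite -mulrA divff ?gt_eqF//.
by rewrite mulr1 -expr2 sqrtr_sqr ger0_norm.
Qed.

End VectorSequences.

(** * Orthogonal projectors onto the eigenspaces of a symmetric matrix *)

Section SpectralProjector.
Context {R : realType} {n : nat}.
Implicit Types (A C D Q : 'M[R]_n) (l m : R).

(** The diagonal entries of [C^T *m C] are the squared norms of the columns of [C]. *)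
Lemma mulmx_trmx_eq0 p (C : 'M[R]_(n, p)) : C^T *m C = 0 -> C = 0.
Proof.
move=> CC; apply/matrixP => i j; rewrite mxE.
have : dot (col j C) (col j C) = 0.
  have /(congr1 (fun M : 'M[R]_p => M j j)) := CC; rewrite !mxE; apply: etrans.
  by rewrite dotE; apply: eq_bigr => k _; rewrite !mxE.
by move=> /dot_eq0/colP/(_ i); rewrite !mxE.
Qed.

(** A symmetric matrix and its square have the same row space, so [C] is [D *m (C *m C)] for some
    [D]; then [1%:M - D *m C] projects orthogonally onto the kernel of [C]. *)
Lemma symmetric_kernel_projector C : C^T = C ->
  exists Q D, [/\ 1%:M - Q = D *m C, Q *m C = 0, C *m Q = 0 & Q^T = Q].
Proof.
move=> CT.
have /submxP[D CE] : (C <= C *m C)%MS.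
  (* The product of [C] with the cokernel of [C *m C] has zero Gram matrix. *)
  rewrite submxE; apply/eqP/mulmx_trmx_eq0.
  by rewrite trmx_mul CT mulmxA -(mulmxA _ C C) -mulmxA mulmx_coker mulmx0.
pose Q := 1%:M - D *m C.
have QC : Q *m C = 0 by rewrite /Q mulmxBl mul1mx -mulmxA -CE subrr.
have CQT : C *m Q^T = 0 by rewrite -{1}CT -trmx_mul QC trmx0.
have QQT : Q *m Q^T = Q^T.
  by rewrite {1}/Q mulmxBl mul1mx -mulmxA CQT mulmx0 subr0.
(* The left side of [QQT] is symmetric, hence so is its right side. *)
have QT : Q^T = Q by rewrite -[LHS]QQT -[RHS]trmxK -[in RHS]QQT trmx_mul trmxK.
by exists Q, D; split=> //; [rewrite /Q opprB addrC subrK | rewrite -{1}QT].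
Qed.

(** These equations only place the range inside the eigenspace, and [Q = 0] satisfies them. That [Q]
    is the identity on the whole eigenspace is carried separately by a factorization of [1%:M - Q]
    through [A - l%:M]. *)
Definition is_spectral_projector A l Q :=
  [/\ Q *m A = l *: Q, A *m Q = l *: Q, Q^T = Q & Q *m Q = Q].

Lemma spectral_projector_exists A l : A^T = A ->
  exists Q D, is_spectral_projector A l Q /\ 1%:M - Q = D *m (A - l%:M).
Proof.
move=> AT; have [|Q [D [QD QC CQ QT]]] := symmetric_kernel_projector (A - l%:M).
  by rewrite linearB/= AT tr_scalar_mx.
exists Q, D; split=> //; split => //.
- by apply/eqP; rewrite -subr_eq0 -mul_mx_scalar -mulmxBr QC.
- by apply/eqP; rewrite -subr_eq0 -mul_scalar_mx -mulmxBl CQ.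
- apply/esym/eqP; rewrite -subr_eq0 -{1}[Q]mul1mx -mulmxBl QD.
  by rewrite -mulmxA CQ mulmx0.
Qed.

(** Evaluating [Q *m A *m Q'] from either side gives both [l] and [m] times [Q *m Q']. *)
Lemma spectral_projector_orthogonal {A l m Q Q'} : l != m ->
  is_spectral_projector A l Q -> is_spectral_projector A m Q' -> Q *m Q' = 0.
Proof.
move=> lm [QA _ _ _] [_ AQ _ _].
have : (l - m) *: (Q *m Q') = 0.
  by rewrite scalerBl scalemxAl -QA scalemxAr -AQ mulmxA subrr.
by move/eqP; rewrite scaler_eq0 subr_eq0 (negbTE lm) => /eqP.
Qed.

(** [Q'] commutes with [A], so the two factorizations can be merged. The component outside both
    eigenspaces is thus controlled by the product of the shifts. *)
Lemma spectral_projector_prod {A l m Q Q' D D'} :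
  is_spectral_projector A m Q' ->
  1%:M - Q = D *m (A - l%:M) -> 1%:M - Q' = D' *m (A - m%:M) ->
  (1%:M - Q) *m (1%:M - Q') = D *m D' *m ((A - m%:M) *m (A - l%:M)).
Proof.
move=> [QA AQ _ _] -> QD.
have -> : D *m (A - l%:M) *m (1%:M - Q') = D *m ((1%:M - Q') *m (A - l%:M)).
  rewrite -mulmxA; congr (_ *m _).
  rewrite mulmxBr mulmx1 (mulmxBl 1%:M) mul1mx; congr (_ - _).
  by rewrite mulmxBl mulmxBr QA AQ mul_mx_scalar mul_scalar_mx.
by rewrite QD !mulmxA.
Qed.

End SpectralProjector.

(** * Auxiliary facts on shifted products, squares and eigenspaces *)

Lemma shifted_product_mul (R : realType) n (A : 'M[R]_n) (x a : R) (v : 'cV[R]_n) :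
  (A - (x - a)%:M) *m (A - (x + a)%:M) *m v =
  A *m (A *m v) - (2 * x) *: (A *m v) + (x ^+ 2 - a ^+ 2) *: v.
Proof.
rewrite -mulmxA !(mulmxBl A) !mul_scalar_mx mulmxBr -scalemxAr.
move: (A *m (A *m v)) (A *m v) => w1 w2; apply/colP => i; rewrite !mxE; ring.
Qed.

Lemma cvg0_of_sqr (R : realType) (x : nat -> R) :
  (fun k => x k ^+ 2) @ \oo --> 0 -> x @ \oo --> 0.
Proof.
move=> x2; apply/cvgrPdist_lt => e e0.
have /cvgrPdist_lt/(_ (e ^+ 2)) := x2; rewrite exprn_gt0// => /(_ erefl).
apply: filterS => k; rewrite !sub0r !normrN ger0_norm ?sqr_ge0// => lte.
rewrite -(@ltr_pXn2r _ 2) ?nnegrE ?normr_ge0 ?(ltW e0)//.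
by rewrite real_normK ?num_real.
Qed.

Lemma sub_col_eigenspace (R : realType) n (A : 'M[R]_n) (a : R) (v : 'cV[R]_n) :
  (v^T <= col_eigenspace A a)%MS <-> A *m v = a *: v.
Proof.
rewrite /col_eigenspace; split.
  move=> /eigenspaceP; rewrite -trmx_mul => /(congr1 trmx).
  by rewrite trmxK linearZ/= trmxK.
by move=> Av; apply/eigenspaceP; rewrite -trmx_mul Av linearZ.
Qed.

Lemma dist_subspace_mem (R : realType) n (W : 'M[R]_n) (v : 'cV[R]_n) :
  (v^T <= W)%MS -> dist_subspace W v = 0.
Proof.
move=> vW; apply/eqP; rewrite eq_le; apply/andP; split.
  apply: ge_inf; first by exists 0 => _ [w [_ ->]]; exact: sqrtr_ge0.
  exists v; split => //; rewrite subrr /euclid_norm big1 ?sqrtr0// => i _.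
  by rewrite mxE expr0n.
apply: lb_le_inf; last by move=> _ [w [_ ->]]; exact: sqrtr_ge0.
by exists (euclid_norm (v - v)), v.
Qed.

(** * Invariants along an MSJD sequence *)

Section Sequence.
Context {R : realType} {n : nat} {A : 'M[R]_n} {u : nat -> 'cV[R]_n}.
Context (hA : A^T = A) (hu : msjd_sequence A u).

Let rho k := rayleigh A (u k).
Let r k := dot (residual A (u k)) (residual A (u k)).

Lemma msjd_unit k : dot (u k) (u k) = 1.
Proof.
case: hu => u0 step; elim: k => [|k uk].
  by rewrite -sqr_euclid_norm u0 expr1n.
by have [c [d [[]]]] := msjd_stepP hA uk (step k).
Qed.

Lemma msjd_seq_stepP k : exists c d : R,
  [/\ [/\ 0 < d <= 1, dot (u k) (u k.+1) = d & 0 <= c <= r k],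
      A *m (A *m u k.+1) - (2 * rho k) *: (A *m u k.+1)
        + rho k ^+ 2 *: u k.+1 = c *: u k,
      r k.+1 + (rho k.+1 - rho k) ^+ 2 = c * d & c * d <= r k].
Proof.
case: hu => _ step; have [c [d /= [[d01 ud _] B m c0 cr]]] :=
  msjd_stepP hA (msjd_unit k) (step k).
exists c, d; split => //; rewrite -B mulmxBr -scalemxAr.
move: (A *m (A *m u k.+1)) (A *m u k.+1) => w1 w2.
apply/colP => i; rewrite !mxE /rho; ring.
Qed.

Lemma residual_decr k : r k.+1 + (rho k.+1 - rho k) ^+ 2 <= r k.
Proof. by have [c [d [_ _ -> ]]] := msjd_seq_stepP k. Qed.

Lemma rayleigh_bounded : exists2 K, 0 <= K &
  forall k, dot (A *m u k) (A *m u k) <= K /\ rho k ^+ 2 <= K.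
Proof.
have [K K0 HK] := dot_mulmx_bounded A; exists K => // k.
have := HK (u k); rewrite msjd_unit mulr1 => Au; split => //.
(* At shift zero Pythagoras reads |A u|^2 = r + rho^2, so one bound serves both quantities. *)
have := dot_shift (A := A) (u k) 0 (msjd_unit k); rewrite scale0r !subr0 => E.
by move: Au; rewrite E; have := dot_ge0 (residual A (u k)); rewrite /rho; lra.
Qed.

(* Both Q u_k and Q u_(k+1) are compared through (A - rho_k)^2 u_(k+1) = c u_k,
   on which Q acts as (l - rho_k)^2. *)
Lemma spectral_projector_step l Q k : is_spectral_projector A l Q ->
  r k.+1 != 0 -> Q *m u k != 0 ->
  exists2 t : R, 0 <= t & Q *m u k.+1 = t *: (Q *m u k).
Proof.
move=> [QA _ _ _] rk Qu0; have [c [d [[/andP[d0 _] _ /andP[c0 _]] B m _]]] :=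
  msjd_seq_stepP k.
(* A zero multiplier would make the next residual vanish. *)
have cgt : c != 0.
  apply/eqP => c00; move: m rk; rewrite c00 mul0r => m.
  suff -> : r k.+1 = 0 by rewrite eqxx.
  have := dot_ge0 (residual A (u k.+1)); have := sqr_ge0 (rho k.+1 - rho k).
  by rewrite /r in m *; lra.
have E : (l - rho k) ^+ 2 *: (Q *m u k.+1) = c *: (Q *m u k).
  rewrite [RHS]scalemxAr -B !mulmxDr !mulmxN -!scalemxAr !mulmxA QA -!scalemxAl QA.
  rewrite -!scalemxAl.
  move: (Q *m u k.+1) => w; apply/colP => i; rewrite !mxE; ring.
(* If [rho k] were equal to [l], then [E] would annihilate the nonzero vector [Q *m u k]. *)
have lr : (l - rho k) ^+ 2 != 0.
  apply/eqP => l0; move: E; rewrite l0 scale0r => /esym/eqP.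
  by rewrite scaler_eq0 (negbTE cgt) (negbTE Qu0).
exists (c / (l - rho k) ^+ 2); first by rewrite divr_ge0// sqr_ge0.
by rewrite mulrC -scalerA -E scalerA mulVf// scale1r.
Qed.

(** The positive limit keeps the component eventually nonzero, so it is only rescaled from then on,
    and its limit has squared norm [a]. *)
Lemma spectral_component_cvg l Q (a : R) : is_spectral_projector A l Q ->
  (forall k, r k != 0) -> 0 < a ->
  (fun k => dot (Q *m u k) (Q *m u k)) @ \oo --> a ->
  exists v, [/\ (fun k => Q *m u k) @ \oo --> v, A *m v = l *: v & v != 0].
Proof.
move=> hQ rk a0 cva; have [|v Qv] := cvg_fixed_direction _ _ _ cva.
  move/cvgrPdist_lt: (cva) => /(_ _ a0); apply: filterS => k Qk.
  apply: (spectral_projector_step l) => //.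
  by apply/eqP => Q0; move: Qk; rewrite Q0 dot0r subr0 gtr0_norm// ltxx.
exists v; split => //.
  case: hQ => QA AQ _ _.
  have := cvg_mulmxr A _ _ Qv.
  rewrite (_ : (fun k => _) = (fun k => l *: (Q *m u k))); last first.
    by apply/funext => k; rewrite mulmxA AQ -scalemxAl.
  move=> AQv; apply: (cvg_unique (@norm_hausdorff _ _) AQv).
  exact: cvgZr.
have va : dot v v = a.
  by have := cvg_dot _ _ _ _ Qv Qv => /(cvg_unique (@norm_hausdorff _ _) cva) <-.
by rewrite -dot_gt0 va.
Qed.

(** * Limits of the Rayleigh quotients and of the vectors *)

Section Limit.
Context (alpha : R) (r_cvg : r @ \oo --> alpha ^+ 2).

Lemma residual_ge k : alpha ^+ 2 <= r k.
Proof.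
rewrite -(cvg_lim _ r_cvg)//; apply: nonincreasing_cvgn_ge; last first.
  by apply/cvg_ex; exists (alpha ^+ 2).
apply/nonincreasing_seqP => i; apply: le_trans (residual_decr i).
by rewrite lerDl sqr_ge0.
Qed.

Lemma rayleigh_step_cvg : (fun k => rho k.+1 - rho k) @ \oo --> 0.
Proof.
apply: cvg0_of_sqr.
apply: (@squeeze_cvgr _ _ _ _ (fun=> 0) (fun k => r k - r k.+1)).
- by apply: nearW => k; rewrite sqr_ge0/= lerBrDl residual_decr.
- exact: cvg_cst.
- rewrite -[X in _ --> X](subrr (alpha ^+ 2)); apply: cvgB => //.
  by move: r_cvg; rewrite -cvg_shiftS.
Qed.

(** By the Lagrange condition the vector is c u_k - alpha^2 u_(k+1), of squared norm c^2 - 2 alpha^2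
    c d + alpha^4; then [c <= r k] and [alpha ^+ 2 <= c * d] apply. *)
Lemma shifted_product_defect k :
  let w := A *m (A *m u k.+1) - (2 * rho k) *: (A *m u k.+1)
             + (rho k ^+ 2 - alpha ^+ 2) *: u k.+1 in
  dot w w <= r k ^+ 2 - alpha ^+ 4.
Proof.
have [c [d [[/andP[d0 d1] ud /andP[c0 cr]] B m cdr]]] := msjd_seq_stepP k.
rewrite /= scalerBl addrA B !dot_lin (dotC (u k.+1)) ud !msjd_unit.
have : alpha ^+ 2 <= c * d.
  by rewrite -m (le_trans (residual_ge k.+1))// lerDl sqr_ge0.
have : c ^+ 2 <= r k ^+ 2 by rewrite lerXn2r ?nnegrE// dot_ge0.
have := sqr_ge0 alpha; rewrite (_ : alpha ^+ 4 = (alpha ^+ 2) ^+ 2); last by ring.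
move: (alpha ^+ 2) => b b0 cr2 bcd.
have : b * b <= b * (c * d) by rewrite ler_wpM2l.
by rewrite expr2; lra.
Qed.

(** Moving the centre from [rho k] to [x] changes the vector by [rho k - x] times a vector that is
    bounded for fixed [x]. *)
Lemma shifted_product_bound : exists2 K, 0 <= K & forall x k,
  let w := (A - (x - alpha)%:M) *m (A - (x + alpha)%:M) *m u k.+1 in
  dot w w <= 2 * (r k ^+ 2 - alpha ^+ 4) + (K + 8 * x ^+ 2) * (rho k - x) ^+ 2.
Proof.
(* Here [16 * K] comes from |A u|^2 and [8 * K] from [rho k ^+ 2]. *)
have [K K0 HK] := rayleigh_bounded; exists (24 * K); first by rewrite mulr_ge0.
move=> x k; rewrite shifted_product_mul /=.
have /= := shifted_product_defect k; set w := (X in dot X X) => wle.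
set w' := (X in dot X X).
have -> : w' = w + (rho k - x) *:
    (2 *: (A *m u k.+1) + (- (x + rho k)) *: u k.+1).
  rewrite /w /w'; move: (A *m (A *m u k.+1)) (A *m u k.+1) => w1 w2.
  apply/colP => i; rewrite !mxE; ring.
apply: (le_trans (dotD_le _ _)); apply: lerD; first by rewrite ler_pM2l.
rewrite dotZl dotZr (mulrA (rho k - x)) -expr2 mulrCA [leRHS]mulrC.
rewrite ler_wpM2l ?sqr_ge0//.
have := dotD_le (2 *: (A *m u k.+1)) (- (x + rho k) *: u k.+1).
move=> H; have {}H : 2 * dot (2 *: (A *m u k.+1) + - (x + rho k) *: u k.+1)
  (2 *: (A *m u k.+1) + - (x + rho k) *: u k.+1) <=
  16 * dot (A *m u k.+1) (A *m u k.+1) + 4 * (x + rho k) ^+ 2.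
  move: H; rewrite !(dotZl _ (2 *: _)) !(dotZr _ (A *m _)).
  rewrite ![dot (- _ *: _) (- _ *: _)]dotZl ![dot (u _) (- _ *: _)]dotZr.
  rewrite msjd_unit; lra.
apply: (le_trans H).
have [Au _] := HK k.+1; have [_ rk] := HK k.
have := sqr_ge0 (x - rho k); lra.
Qed.

Lemma defect_cvg : (fun k => r k ^+ 2 - alpha ^+ 4) @ \oo --> 0.
Proof.
rewrite -[X in _ --> X](subrr (alpha ^+ 4)); apply: cvgB; last exact: cvg_cst.
by rewrite [X in _ --> X](_ : _ = (alpha ^+ 2) ^+ 2); [exact: cvgM | ring].
Qed.

(** Otherwise the product of the two shifts is invertible and cannot make unit vectors arbitrarily
    short, against the bound at indices where [rho k] is near [x] and [r k] near its limit. *)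
Lemma cluster_rayleigh_eigenvalue x : cluster (rho @ \oo) x ->
  root (char_poly A) (x + alpha) || root (char_poly A) (x - alpha).
Proof.
move=> clx; apply: contrapT => /negP; rewrite -!eigenvalue_root_char negb_or.
have unitE a : ~~ eigenvalue A a -> A - a%:M \in unitmx.
  rewrite /eigenvalue negbK /eigenspace => /eqP ker0.
  by rewrite -row_free_unit -kermx_eq0 ker0.
move=> /andP[/unitE up /unitE um].
set M := (A - (x - alpha)%:M) *m (A - (x + alpha)%:M).
have unitM : M \in unitmx by rewrite unitmx_mul um up.
have [C C0 HC] := dot_mulmx_bounded (invmx M).
have [K K0 HK] := shifted_product_bound.
set K' := K + 8 * x ^+ 2; have K'0 : 0 <= K'.
  by rewrite addr_ge0// mulr_ge0// sqr_ge0.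
have lb k : 1 <= C * (2 * (r k ^+ 2 - alpha ^+ 4) + K' * (rho k - x) ^+ 2).
  have := HC (M *m u k.+1); rewrite mulKmx// msjd_unit => H.
  by apply: (le_trans H); rewrite ler_wpM2l//; exact: HK.
have C1 : 0 < C + 1 by rewrite ltr_wpDl.
have K1 : 0 < K' + 1 by rewrite ltr_wpDl.
(* [e] and the later [h] give [C * (K' * e) <= 1 / 4] and [C * h <= 1 / 8], so the upper bound is at
   most 1/2 while [lb] demands 1. *)
pose e := ((C + 1) * (K' + 1) * 4)^-1.
have D1 : 1 <= (C + 1) * (K' + 1) * 4.
  have : 0 <= C * K' by rewrite mulr_ge0.
  by move: (C0) (K'0); lra.
have e0 : 0 < e by rewrite invr_gt0 (lt_le_trans ltr01).
have e1 : e <= 1 by rewrite invf_le1// (lt_le_trans ltr01).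
pose h := ((C + 1) * 8)^-1; have h0 : 0 < h by rewrite invr_gt0 mulr_gt0.
move/cvgrPdist_lt: defect_cvg => /(_ _ h0)[N _ HN].
move/cluster_eventuallyP: clx => /(_ e N e0)[k Nk ke].
have := HN k Nk; rewrite /= sub0r normrN => /ltr_normlW dk.
have sq : (rho k - x) ^+ 2 <= e.
  rewrite -sqrrN opprB -real_normK ?num_real//.
  apply: (@le_trans _ _ (e * e)); last by rewrite ler_piMr// ltW.
  by rewrite expr2 ler_pM.
have := lb k; apply/negP; rewrite -ltNge.
have Ce : C * (K' * e) <= 1 / 4.
  rewrite /e mulrA ler_pdivrMr ?(lt_le_trans ltr01)//.
  have : 0 <= C + K' by rewrite addr_ge0.
  by lra.
have Ch : C * h <= 1 / 8.
  by rewrite /h ler_pdivrMr ?mulr_gt0//; lra.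
apply: (@le_lt_trans _ _ (C * (2 * h + K' * e))).
  by rewrite ler_wpM2l// lerD//; [rewrite ler_pM2l// ltW|rewrite ler_wpM2l].
lra.
Qed.

Lemma rayleigh_cvg : exists x : R, rho @ \oo --> x.
Proof.
have [K K0 HK] := rayleigh_bounded.
(* The roots of [p] are the points whose translate by [alpha] or [- alpha] is an eigenvalue. *)
pose p := (char_poly A \Po (1 *: 'X + alpha%:P))
          * (char_poly A \Po (1 *: 'X + (- alpha)%:P)).
have ch0 : char_poly A != 0 by rewrite monic_neq0// char_poly_monic.
have p0 : p != 0 by rewrite mulf_neq0// poly_comp_linear_neq0// oner_neq0.
apply: (cvg_of_cluster_roots rho (K + 1) p p0) => [k||].
- have [_ rk] := HK k; rewrite -(@ler_pXn2r _ 2) ?nnegrE ?addr_ge0//.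
  rewrite real_normK ?num_real// (le_trans rk)//.
  by have := sqr_ge0 K; lra.
- exact: rayleigh_step_cvg.
- move=> x /cluster_rayleigh_eigenvalue.
  by rewrite /root /p hornerM !horner_comp !hornerE mulf_eq0.
Qed.

Lemma shifted_product_cvg x : rho @ \oo --> x ->
  (fun k => (A - (x - alpha)%:M) *m (A - (x + alpha)%:M) *m u k) @ \oo
    --> (0 : 'cV[R]_n).
Proof.
move=> rx; rewrite -cvg_shiftS; apply/cvg0_dot.
have [K K0 HK] := shifted_product_bound.
apply: (@squeeze_cvgr _ _ _ _ (fun=> 0) (fun k =>
  2 * (r k ^+ 2 - alpha ^+ 4) + (K + 8 * x ^+ 2) * (rho k - x) ^+ 2)).
- by apply: nearW => k; rewrite dot_ge0; exact: HK.
- exact: cvg_cst.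
- rewrite [X in _ --> X](_ : _ = 2 * 0 + (K + 8 * x ^+ 2) * ((x - x) * (x - x))).
    apply: cvgD; apply: cvgM; [exact: cvg_cst|exact: defect_cvg|exact: cvg_cst|].
    by apply: cvgM; (apply: cvgB; [|exact: cvg_cst]).
  by rewrite subrr !mulr0 addr0.
Qed.

Lemma spectral_projector_defect x Q Q' D D' : rho @ \oo --> x ->
  is_spectral_projector A (x - alpha) Q' ->
  1%:M - Q = D *m (A - (x + alpha)%:M) ->
  1%:M - Q' = D' *m (A - (x - alpha)%:M) ->
  (fun k => (1%:M - Q) *m (1%:M - Q') *m u k) @ \oo --> (0 : 'cV[R]_n).
Proof.
move=> rx pQ QD QD'; rewrite (spectral_projector_prod pQ QD QD').
have := cvg_mulmxr (D *m D') _ _ (shifted_product_cvg x rx); rewrite mulmx0.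
by under eq_fun do rewrite mulmxA.
Qed.

(** Both shifts coincide and [1%:M - Q] is idempotent, so the part of [u k] off the eigenspace tends
    to 0 and |Q u_k|^2 to 1. *)
Lemma cvg_eigenvector x : alpha = 0 -> (forall k, r k != 0) -> rho @ \oo --> x ->
  exists v, (u @ \oo --> v) /\ is_eigenvector A x v.
Proof.
move=> a0 rk rx; have [Q [D [pQ QD]]] := spectral_projector_exists A x hA.
have := spectral_projector_defect x Q Q D D rx; rewrite a0 subr0 addr0.
move=> /(_ pQ QD QD).
have [QA AQ QT QQ] := pQ.
have -> : (1%:M - Q) *m (1%:M - Q) = 1%:M - Q.
  by rewrite mulmxBr mulmx1 mulmxBl mul1mx QQ subrr subr0.
move=> e0.
have Qd k : dot (Q *m u k) (Q *m u k)
    = 1 - dot ((1%:M - Q) *m u k) ((1%:M - Q) *m u k).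
  have E : dot (u k) (Q *m u k) = dot (Q *m u k) (Q *m u k).
    by rewrite dot_mulmxl QT mulmxA QQ.
  by rewrite mulmxBl mul1mx !dot_lin (dotC (Q *m u k) (u k)) E msjd_unit; ring.
have [|v [Qv Av v0]] := spectral_component_cvg x Q 1 pQ rk ltr01.
  rewrite (funext Qd) -[X in _ --> X]subr0; apply: cvgB; first exact: cvg_cst.
  by apply/cvg0_dot.
exists v; split => //.
have uE : u = fun k => Q *m u k + (1%:M - Q) *m u k.
  by apply/funext => k; rewrite -mulmxDl addrC subrK mul1mx.
by rewrite uE -[v]addr0; exact: cvgD.
Qed.

(** Two linear relations fix the weights of the two components: their sum tends to 1, and their
    difference to 0 because [rho k] tends to the midpoint [x]. *)
Lemma cvg_bisector x : 0 < alpha -> rho @ \oo --> x ->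
  exists v vp vm : 'cV[R]_n, [/\ u @ \oo --> v, v = vp + vm,
    is_eigenvector A (x + alpha) vp & is_eigenvector A (x - alpha) vm].
Proof.
move=> a0 rx.
have rk k : r k != 0.
  by rewrite gt_eqF// (lt_le_trans _ (residual_ge k))// exprn_gt0.
have [P [D [pP PD]]] := spectral_projector_exists A (x + alpha) hA.
have [Q [D' [pQ QD]]] := spectral_projector_exists A (x - alpha) hA.
have := spectral_projector_defect x P Q D D' rx pQ PD QD.
have PQ : P *m Q = 0.
  apply: (spectral_projector_orthogonal (l := x + alpha) (m := x - alpha) _ pP pQ).
  by apply/eqP; move: a0; lra.
have -> : (1%:M - P) *m (1%:M - Q) = 1%:M - P - Q.
  by rewrite mulmxBr mulmx1 mulmxBl mul1mx PQ subr0.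
set e := (fun k => _ *m u k) => e0.
have eE k : e k = u k - P *m u k - Q *m u k by rewrite /e !mulmxBl mul1mx.
have [PA AP PT PP] := pP; have [QA AQ QT QQ] := pQ.
have uP k : dot (u k) (P *m u k) = dot (P *m u k) (P *m u k).
  by rewrite dot_mulmxl PT mulmxA PP.
have uQ k : dot (u k) (Q *m u k) = dot (Q *m u k) (Q *m u k).
  by rewrite dot_mulmxl QT mulmxA QQ.
have PQ0 k : dot (P *m u k) (Q *m u k) = 0.
  by rewrite dot_mulmxl PT mulmxA PQ mul0mx dot0r.
pose a k := dot (P *m u k) (P *m u k); pose b k := dot (Q *m u k) (Q *m u k).
have ab k : a k + b k = 1 - dot (e k) (e k).
  rewrite eE !dot_lin (dotC (P *m u k) (u k)) (dotC (Q *m u k) (u k)).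
  by rewrite (dotC (Q *m u k) (P *m u k)) PQ0 uP uQ msjd_unit /a /b; ring.
have rE k : rho k = (x + alpha) * a k + (x - alpha) * b k + dot (e k) (A *m e k).
  have APu : A *m (P *m u k) = (x + alpha) *: (P *m u k).
    by rewrite mulmxA AP -scalemxAl.
  have AQu : A *m (Q *m u k) = (x - alpha) *: (Q *m u k).
    by rewrite mulmxA AQ -scalemxAl.
  have PAu : dot (P *m u k) (A *m u k) = (x + alpha) * a k.
    by rewrite dotC dot_symmetric// APu dotZr uP.
  have QAu : dot (Q *m u k) (A *m u k) = (x - alpha) * b k.
    by rewrite dotC dot_symmetric// AQu dotZr uQ.
  rewrite eE !mulmxBr APu AQu !dot_lin PAu QAu !uP !uQ (dotC (Q *m _)) !PQ0.
  by rewrite /rho rayleighE /a /b; ring.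
have ee : (fun k => dot (e k) (e k)) @ \oo --> 0 by apply/cvg0_dot.
have eAe : (fun k => dot (e k) (A *m e k)) @ \oo --> 0.
  rewrite -[X in _ --> X](dot0r (0 : 'cV[R]_n)) -[X in dot _ X](mulmx0 _ A).
  by apply: cvg_dot => //; exact: cvg_mulmxr.
(* This is [rE] solved for [a k - b k] with the help of [ab]. *)
pose g k := (rho k - x * (1 - dot (e k) (e k)) - dot (e k) (A *m e k)) / alpha.
have gE k : g k = a k - b k.
  by rewrite /g -ab rE; field; rewrite gt_eqF.
have s1 : (fun k => 1 - dot (e k) (e k)) @ \oo --> (1 : R).
  by rewrite -[X in _ --> X]subr0; apply: cvgB => //; exact: cvg_cst.
have gcv : g @ \oo --> 0.
  rewrite [X in _ --> X](_ : _ = (x - x * 1 - 0) / alpha);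
    last by field; rewrite gt_eqF.
  apply: cvgM; last exact: cvg_cst.
  apply: cvgB => //; apply: cvgB => //; apply: cvgM => //; exact: cvg_cst.
have acv : a @ \oo --> (2^-1 : R).
  rewrite [X in _ --> X](_ : _ = (1 + 0) / 2); last by field.
  rewrite (_ : a = (fun k => (1 - dot (e k) (e k) + g k) / 2)).
    by apply: cvgM; [exact: cvgD|exact: cvg_cst].
  by apply/funext => k; rewrite gE -ab; field.
have bcv : b @ \oo --> (2^-1 : R).
  rewrite [X in _ --> X](_ : _ = (1 - 0) / 2); last by field.
  rewrite (_ : b = (fun k => (1 - dot (e k) (e k) - g k) / 2)).
    by apply: cvgM; [exact: cvgB|exact: cvg_cst].
  by apply/funext => k; rewrite gE -ab; field.
have h0 : 0 < 2^-1 :> R by rewrite invr_gt0.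
have [vp [Pv Avp vp0]] := spectral_component_cvg (x + alpha) P _ pP rk h0 acv.
have [vm [Qv Avm vm0]] := spectral_component_cvg (x - alpha) Q _ pQ rk h0 bcv.
exists (vp + vm), vp, vm; split => //.
have uE : u = fun k => P *m u k + Q *m u k + e k.
  by apply/funext => k; rewrite eE -(addrA (u k)) -opprD [RHS]addrC subrK.
by rewrite uE -[vp + vm]addr0; apply: cvgD => //; exact: cvgD.
Qed.

End Limit.

(** * Sequences that reach an exact eigenvector *)

Lemma residual_zero_stays k0 : r k0 = 0 -> forall k,
  r (k + k0)%N = 0 /\ rho (k + k0)%N = rho k0.
Proof.
move=> r0; elim=> [//|k [rk rhok]]; rewrite addSn.
have := residual_decr (k + k0); rewrite rk rhok.
have := dot_ge0 (residual A (u (k + k0).+1)); rewrite -/(r _).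
have := sqr_ge0 (rho (k + k0).+1 - rho k0) => H1 H2 H3.
split; first by lra.
apply/eqP; rewrite -subr_eq0 -sqrf_eq0; apply/eqP; lra.
Qed.

(** At an exact eigenvector the minimizers of Step 1 leave the direction within the eigenspace free,
    so in a multiple eigenspace only the distance to it is controlled. In a simple one just a sign
    is open. *)
Lemma cvg_of_residual_zero k0 : r k0 = 0 ->
  (rho @ \oo --> rho k0) /\
  ((exists v, (u @ \oo --> v) /\ is_eigenvector A (rho k0) v) \/
   (1 < \rank (col_eigenspace A (rho k0)))%N /\
   (fun k => dist_subspace (col_eigenspace A (rho k0)) (u k)) @ \oo --> (0 : R)).
Proof.
move=> r0; have st := residual_zero_stays k0 r0.
have eig k : A *m u (k + k0)%N = rho k0 *: u (k + k0)%N.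
  by have [/eqP/residual_eq0P] := st k; rewrite -/(rho _) => -> ->.
split.
  rewrite -(cvg_shiftn k0) (_ : (fun k => _) = fun=> rho k0); first exact: cvg_cst.
  by apply/funext => k; have [] := st k.
case: (ltnP 1 (\rank (col_eigenspace A (rho k0)))) => rk; [right|left].
  split => //; rewrite -(cvg_shiftn k0) (_ : (fun k => _) = fun=> 0).
    exact: cvg_cst.
  by apply/funext => k; apply/dist_subspace_mem/sub_col_eigenspace.
have u0 : u k0 != 0 by rewrite -dot_gt0 msjd_unit ltr01.
exists (u k0); split; last by split => //; exact: (eig 0%N).
have sub : (col_eigenspace A (rho k0) <= (u k0)^T)%MS.
  have uE : ((u k0)^T <= col_eigenspace A (rho k0))%MS.
    by apply/sub_col_eigenspace; exact: (eig 0%N).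
  rewrite -(geq_leqif (mxrank_leqif_sup uE)) (leq_trans rk)//.
  by rewrite lt0n mxrank_eq0 trmx_eq0.
have cst k : u (k + k0)%N = u k0.
  elim: k => [//|k IH]; rewrite addSn.
  have /sub_col_eigenspace/submx_trans/(_ sub)/sub_rVP[t] := eig k.+1.
  rewrite addSn -linearZ/= => /trmx_inj ut.
  (* The positive inner product [d] of consecutive iterates rules out a change of sign. *)
  have [c [d [[/andP[d0 _] ud _] _ _ _]]] := msjd_seq_stepP (k + k0).
  have := msjd_unit (k + k0).+1; move: ud; rewrite IH ut !dot_lin msjd_unit !mulr1.
  move=> td /eqP; rewrite -expr2 sqrf_eq1 => /orP[/eqP->|/eqP t1].
    by rewrite scale1r.
  by move: d0; rewrite -td t1 oppr_gt0 ltr10.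
rewrite -(cvg_shiftn k0) (_ : (fun k => _) = fun=> u k0); first exact: cvg_cst.
by apply/funext => k; exact: cst.
Qed.

End Sequence.

Theorem theorem3p4 (R : realType) (n : nat) (A : 'M[R]_n)
    (u : nat -> 'cV[R]_n) (alpha : R)
    (hA : A^T = A)
    (hu : msjd_sequence A u)
    (halpha : 0 <= alpha)
    (hlim : (fun k : nat => euclid_norm (residual A (u k)) ^+ 2) @ \oo
              --> alpha ^+ 2) :
  exists rho : R,
    ((fun k : nat => rayleigh A (u k)) @ \oo --> rho) /\
    ((* an eigenvector for rho *)
     (exists v : 'cV[R]_n, (u @ \oo --> v) /\ is_eigenvector A rho v)
     \/
     (* the invariant subspace of the multiple eigenvalue rho, once some
        iterate is an exact eigenvector and Step 1 becomes indeterminate *)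
     ([/\ (1 < \rank (col_eigenspace A rho))%N,
          exists k : nat, residual A (u k) = 0
        & (fun k : nat => dist_subspace (col_eigenspace A rho) (u k)) @ \oo
            --> (0 : R)])
     \/
     (* the invariant subspace spanned by the eigenvectors for rho +/- alpha *)
     (exists v : 'cV[R]_n,
        [/\ u @ \oo --> v,
            exists w : 'cV[R]_n, is_eigenvector A (rho + alpha) w,
            exists w : 'cV[R]_n, is_eigenvector A (rho - alpha) w
          & (v^T <= col_eigenspace A (rho + alpha)
                    + col_eigenspace A (rho - alpha))%MS])).
Proof.
(* A vanishing residual is treated apart, since the rescaling of eigencomponents relies on nonzero
   residuals. *)
have [[k0 res0]|nores] := pselect (exists k, residual A (u k) = 0).
  have [|rx cases] := cvg_of_residual_zero hA hu k0; first by rewrite res0 dot0r.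
  exists (rayleigh A (u k0)); split => //.
  case: cases => [?|[? ?]]; first by left.
  by right; left; split => //; exists k0.
have r_cvg : (fun k => dot (residual A (u k)) (residual A (u k))) @ \oo
    --> alpha ^+ 2.
  by under eq_fun do rewrite -sqr_euclid_norm.
have [x rx] := rayleigh_cvg hA hu alpha r_cvg.
exists x; split => //.
have [a0|a0] := eqVneq alpha 0.
  left; apply: (cvg_eigenvector hA hu alpha r_cvg) => // k.
  by apply/eqP => /dot_eq0 rk; apply: nores; exists k.
have [|v [vp [vm [uv vE evp evm]]]] := cvg_bisector hA hu alpha r_cvg x _ rx.
  by rewrite lt0r a0.
right; right; exists v; split => //; [by exists vp|by exists vm|].
rewrite vE linearD/= addmx_sub_adds//; apply/sub_col_eigenspace.
  by case: evp.
by case: evm.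
Qed.
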